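(* Let $\beta>0$ and let $c=c(\beta)>0$ be a constant with property (P) described in the context. Let $x=(x_n)_{n\ge1}\in \ell^2(\mathbb{R})$, $x\neq0$, with $x_n\ge0$ for all $n$, let $X=(X_n)_{n\ge1}$ be a weak solution of the inviscid dyadic system $$\dot X_n = k_{n-1}X_{n-1}^2-k_nX_nX_{n+1},\qquad X_n(0)=x_n,\qquad n\ge1,\ t\ge0,$$ with initial condition $x$, and let $T>0$. Then for all $N\ge1$ such that $k_NT>c\|x\|^{-1}$ the following inequality holds: $$\int_0^TX_N^3(t)\,dt\le\frac{c\,\|x\|^2}{k_N}\left(1+\log\left(\frac{\|x\|T}{c}\right)+N\beta\log 2\right).$$
   Context: Conventions: $k_n=2^{\beta n}$ for $n\ge1$, $k_0=0$ and $X_0\equiv0$; $\|\cdot\|$ is the usual norm of $\ell^2(\mathbb{R})$; $\mathcal{L}$ denotes Lebesgue measure; $\log$ is the natural logarithm. A weak solution is a sequence $X=(X_n)_{n\ge1}$ of real-valued differentiable functions on $[0,\infty)$ satisfying the system (equations and initial conditions) for all $n\ge1$ and $t\ge0$. Property (P) of the constant $c=c(\beta)$, which depends only on $\beta$: for every $x\in\ell^2(\mathbb{R})$ with $x_n\ge0$ for all $n$, every weak solution $X$ with initial condition $x$, every $n\ge1$ and every $M>0$, $$\mathcal{L}\{t\ge0\mid X_n(t)>M\}\le\frac{c\,\|x\|^2}{k_nM^3}.$$ (Such a constant exists for each $\beta>0$.) *)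

(* Defs.v *)
From HB Require Import structures.
From mathcomp Require Import all_boot all_order all_algebra.
From mathcomp Require Import all_classical all_reals all_analysis.

Set Implicit Arguments.
Unset Strict Implicit.
Unset Printing Implicit Defensive.

Import Order.TTheory GRing.Theory Num.Theory.
Import numFieldNormedType.Exports.

Local Open Scope classical_set_scope.
Local Open Scope ring_scope.

(* A sequence (x_n)_{n >= 1} is represented by a function nat -> R whose value
   at 0 is ignored. *)

Definition k (R : realType) (beta : R) (n : nat) : R :=
  if n is 0 then 0 else 2 `^ (beta * n%:R).

(* The composition with succn restricts the norm to the indices n >= 1. *)
Definition in_ell2 (R : realType) (x : nat -> R) : Prop :=
  finite_norm (@counting nat R) 2%:E (x \o succn).

Definition ell2_norm (R : realType) (x : nat -> R) : R :=
  fine ('N[@counting nat R]_2%:E[EFin \o (x \o succn)])%E.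

(* The derivative of f at t relative to [0, +oo[: one-sided at t = 0, and the
   usual one at t > 0. *)
Definition has_derivative_ge0 (R : realType) (f : R -> R) (t l : R) : Prop :=
  ((f s - f t) / (s - t)) @[s --> within [set s | 0 <= s] t^'] --> l.

(* In the second clause, n stands for n - 1 in the usual indexing by n >= 1;
   values of X at negative times are unconstrained. *)
Definition weak_solution (R : realType) (beta : R) (x : nat -> R)
    (X : nat -> R -> R) : Prop :=
  [/\ forall t, 0 <= t -> X 0 t = 0,
      forall n t, 0 <= t ->
        has_derivative_ge0 (X n.+1) t
          (k beta n * X n t ^+ 2 - k beta n.+1 * X n.+1 t * X n.+2 t) &
      forall n, X n.+1 0 = x n.+1].

Definition property_P (R : realType) (beta c : R) : Prop :=
  forall (x : nat -> R) (X : nat -> R -> R),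
    in_ell2 x -> (forall n, (1 <= n)%N -> 0 <= x n) ->
    weak_solution beta x X ->
    forall (n : nat) (M : R), (1 <= n)%N -> 0 < M ->
      (@lebesgue_measure R [set t | (0 <= t)%R /\ (M < X n t)%R]
         <= (c * ell2_norm x ^+ 2 / (k beta n * M ^+ 3))%:E)%E.

(* Main.v *)
Require Import Defs.
From mathcomp Require Import all_boot all_order all_algebra.
From mathcomp Require Import all_classical all_reals all_analysis.
From mathcomp Require Import measurable_realfun.
From mathcomp Require Import ring lra.

(** Write [E] for [ell2_norm x] and [k] for [k_N]. Two facts bound the size
    of [X_N].

    - It never exceeds [E]. Nonnegative initial data stay nonnegative
      ([weak_solution_ge0]), because the only term of the equation of [X_n] that
      can be negative is proportional to [X_n] itself. The derivative of
      [X_1^2 + ... + X_n^2] telescopes to [- 2 k_n X_n^2 X_(n+1)], which is then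
      nonpositive, so this partial energy stays below its initial value
      ([energy_le]), hence below [E^2].

    - It is rarely large. Property (P), read at the level [s = M^3], says that
      the times at which [X_N^3 > s] have measure at most [C / s], where
      [C = c E^2 / k]; on [[0, T]] that measure is also at most [T].

    By the layer-cake formula the integral of [X_N^3] over [[0, T]] is the
    integral over [s] in [[0, E^3]] of the measure of the times at which
    [X_N^3 > s], so it is at most the integral of [min (T, C / s)]. The two
    bounds cross at [s = C / T], which is below [E^3] exactly when
    [k T > c / E]. The part below the crossing contributes [C], the part above
    it [C ln (E^3 T / C)], and [E^3 T / C = E T k / c] with
    [ln k = N beta ln 2]. The layer-cake step is carried out for a random
    variable ([expectation_le_of_weak_type]) and transferred to [[0, T]] by the
    uniform probability ([integral_le_of_weak_type]). *)

Import Order.TTheory GRing.Theory Num.Theory.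
Import numFieldNormedType.Exports.

Set Implicit Arguments.
Unset Strict Implicit.
Unset Printing Implicit Defensive.

Local Open Scope classical_set_scope.
Local Open Scope ring_scope.

(** * Derivatives relative to the half-line *)

(** A convergent difference quotient times [s - t] tends to [0]. *)
Lemma has_derivative_ge0_within_continuous {R : realType} (f df : R -> R) :
  (forall t, 0 <= t -> has_derivative_ge0 f t (df t)) ->
  {within [set t | 0 <= t], continuous f}.
Proof.
move=> fdf; apply/subspace_continuousP => t /= t0 U Uft.
have fF : f s @[s --> within [set s | 0 <= s] t^'] --> f t.
  have idF : s @[s --> within [set s | 0 <= s] t^'] --> t.
    by apply: cvg_trans (cvg_within _) _; exact: nbhs_dnbhs.
  have : f t + (f s - f t) / (s - t) * (s - t)
      @[s --> within [set s | 0 <= s] t^'] --> f t + df t * (t - t).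
    apply: cvgD; first exact: cvg_cst.
    apply: cvgM; first exact: fdf.
    by apply: cvgB => //; exact: cvg_cst.
  rewrite subrr mulr0 addr0; apply: cvg_trans; apply: near_eq_cvg.
  rewrite near_withinE; near=> s => _.
  have st : s - t != 0.
    by rewrite subr_eq0; near: s; exact: nbhs_dnbhs_neq.
  by rewrite divfK// addrCA subrr addr0.
(* The limit is punctured at [t], where membership in [U] holds anyway. *)
have H : \forall s \near t, s != t -> 0 <= s -> U (f s) := fF U Uft.
change (\forall s \near t, 0 <= s -> U (f s)).
apply: filterS H => s /= H s0.
have [->|st] := eqVneq s t; first exact: nbhs_singleton.
exact: H.
Unshelve. all: by end_near. Qed.

(** Away from the endpoint the one-sided restriction [0 <= s] is invisible, so
    the usual differential calculus applies. *)
Lemma has_derivative_ge0_is_derive {R : realType} (f : R -> R) (t l : R) :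
  0 < t -> has_derivative_ge0 f t l -> is_derive t 1 f l.
Proof.
move=> t0 fl.
have H : (f s - f t) / (s - t) @[s --> t^'] --> l.
  move=> U lU.
  have H : \forall s \near t^', 0 <= s -> U ((f s - f t) / (s - t)) := fl U lU.
  change (\forall s \near t^', U ((f s - f t) / (s - t))).
  near=> s.
  have : 0 <= s by apply/ltW; near: s; apply: nbhs_dnbhs; exact: lt_nbhsr.
  by near: s; exact: H.
suff: h^-1 *: (f (h *: 1 + t) - f t) @[h --> 0^'] --> l.
  move=> Hl; split; first by apply/cvg_ex; exists l.
  exact: cvg_lim Hl.
have -> : (fun h => h^-1 *: (f (h *: 1 + t) - f t)) =
    (fun s => (f s - f t) / (s - t)) \o (fun h => h + t).
  apply/funext => h /=.
  by rewrite [_ *: 1]mulr1 addrK mulrC.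
move=> U lU.
have H' : \forall s \near t, s != t -> U ((f s - f t) / (s - t)) := H U lU.
change (\forall h \near 0, h != 0 -> U ((f (h + t) - f t) / (h + t - t))).
have shift0 : h + t @[h --> 0] --> t.
  rewrite -[X in _ --> X]add0r.
  by apply: cvgD; [exact: cvg_id|exact: cvg_cst].
have : \forall h \near 0, h + t != t -> U ((f (h + t) - f t) / (h + t - t)) :=
  shift0 _ H'.
apply: filterS => h /= + h0; apply.
by rewrite -subr_eq0 addrK.
Unshelve. all: by end_near. Qed.

(** The differential inequality is only required where [f] is negative. There
    [g s = f s * expR (- (B + 1) * s)] has a positive derivative, so a negative
    minimum of [g] cannot occur: [g] would be smaller just to the left. The rate
    [B + 1] rather than [B] makes that derivative strictly positive. *)
Lemma ge0_of_derivative_ge {R : realType} (f df : R -> R) (B t : R) :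
  (forall s, 0 <= s -> has_derivative_ge0 f s (df s)) ->
  0 <= t -> 0 <= f 0 ->
  (forall s, 0 < s <= t -> f s < 0 -> B * f s <= df s) ->
  0 <= f t.
Proof.
move=> fdf t0 f0 dfB; rewrite leNgt; apply/negP => ft.
pose g s := f s * expR (- (B + 1) * s).
have gsg s : (g s < 0) = (f s < 0) by rewrite pmulr_llt0// expR_gt0.
have cf := has_derivative_ge0_within_continuous fdf.
have cg : {within `[0, t], continuous g}.
  have cf' : {within `[0, t], continuous f}.
    apply: continuous_subspaceW cf => s /=.
    by rewrite in_itv/= => /andP[].
  have ce : {within `[0, t], continuous (fun s : R => expR (- (B + 1) * s))}.
    apply: continuous_subspaceT => s.
    apply: continuous_comp; last exact: continuous_expR.
    by apply: continuousM; [exact: cvg_cst|exact: cvg_id].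
  by move=> s; apply: cvgM; [exact: cf'|exact: ce].
have [s + smin] := EVT_min t0 cg.
rewrite in_itv/= => /andP[s0 st].
have gs : g s < 0.
  by rewrite (le_lt_trans (smin t _)) ?gsg// in_itv/= t0 lexx.
have s_gt0 : 0 < s.
  rewrite lt_neqAle s0 andbT; apply/eqP => s0'.
  by move: gs; rewrite gsg -s0' ltNge f0.
have dg : is_derive s 1 g
    ((df s - (B + 1) * f s) * expR (- (B + 1) * s)).
  have ? := has_derivative_ge0_is_derive s_gt0 (fdf s s0).
  apply: is_derive_eq.
  rewrite /GRing.scale/=; ring.
have dg0 : 0 < (df s - (B + 1) * f s) * expR (- (B + 1) * s).
  rewrite mulr_gt0 ?expR_gt0// subr_gt0 mulrDl mul1r.
  rewrite gsg in gs.
  by have := dfB s; rewrite s_gt0 st => /(_ isT gs); lra.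
have [dg1 dg2] := dg.
have : \forall h \near 0^', 0 < h^-1 *: (g (h *: 1 + s) - g s).
  by apply: cvgr_gt dg0; rewrite -dg2; exact: dg1.
move=> {dg dg1 dg2} dg.
have {}dg : \forall h \near 0,
    h != 0 -> 0 < h^-1 *: (g (h *: 1 + s) - g s) := dg.
near (0 : R)^'- => h.
have h0 : h < 0 by near: h; exact: nbhs_left_lt.
have hs : - s < h by near: h; apply: nbhs_left_gt; rewrite oppr_lt0.
have : g s <= g (h + s).
  by apply: smin; rewrite in_itv/=; apply/andP; split; lra.
have : h != 0 -> 0 < h^-1 *: (g (h *: 1 + s) - g s).
  by near: h; apply: cvg_within; exact: dg.
rewrite lt_eqF// => /(_ isT).
rewrite [_ *: 1]mulr1 /GRing.scale/= nmulr_rgt0 ?invr_lt0// subr_lt0.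
by move=> /lt_le_trans/[apply]; rewrite ltxx.
Unshelve. all: by end_near. Qed.

(** * Positivity and energy bound for the dyadic system *)

Section nonnegative_solution.
Context {R : realType} {beta : R} {x : nat -> R} {X : nat -> R -> R}.
Hypothesis X_sol : weak_solution beta x X.

Let drift (n : nat) (t : R) : R :=
  k beta n * X n t ^+ 2 - k beta n.+1 * X n.+1 t * X n.+2 t.

Lemma k_ge0 n : 0 <= k beta n.
Proof. by case: n => //= n; exact: powR_ge0. Qed.

Let X_derive (n : nat) (t : R) :
  0 <= t -> has_derivative_ge0 (X n.+1) t (drift n t).
Proof. by have [_ XE _] := X_sol; exact: XE. Qed.

Lemma weak_solution_continuous n :
  {within [set t | 0 <= t], continuous (X n.+1)}.
Proof. exact: has_derivative_ge0_within_continuous (@X_derive n). Qed.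

Let X_continuous_segment (n : nat) (t : R) :
  {within `[0, t], continuous (X n.+1)}.
Proof.
apply: continuous_subspaceW (@weak_solution_continuous n) => s /=.
by rewrite in_itv/= => /andP[].
Qed.

Hypothesis x_ge0 : forall n, (1 <= n)%N -> 0 <= x n.

(** In [X_(n+1)' = k_n X_n^2 - k_(n+1) X_(n+1) X_(n+2)] the first term is
    nonnegative and the factor [- k_(n+1) X_(n+2)] is bounded above on [[0, t]],
    so [ge0_of_derivative_ge] applies with its maximum. *)
Lemma weak_solution_ge0 (n : nat) (t : R) : 0 <= t -> 0 <= X n.+1 t.
Proof.
move=> t0.
have cb : {within `[0, t], continuous (fun s => - (k beta n.+1 * X n.+2 s))}.
  move=> s; apply: cvgN; apply: cvgM; first exact: cvg_cst.
  exact: X_continuous_segment.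
have [m _ bm] := EVT_max t0 cb.
apply: (ge0_of_derivative_ge (@X_derive n) t0).
  by have [_ _ ->] := X_sol; exact: x_ge0.
move=> s /andP[s0 st] Xs.
have := bm s; rewrite in_itv/= ltW// st => /(_ isT) sm.
apply: le_trans (ler_wnM2r (ltW Xs) sm) _.
rewrite /drift mulNr mulrAC -[leLHS]add0r lerD2r.
by rewrite mulr_ge0 ?k_ge0// sqr_ge0.
Qed.

(** The energy that mode [i] gives to mode [i + 1] cancels in the sum: only the
    flux out of the last mode remains. *)
Lemma is_derive_energy (n : nat) (t : R) : 0 < t ->
  is_derive t 1 (fun s => \sum_(0 <= i < n) X i.+1 s ^+ 2)
    (- 2 * k beta n * X n t ^+ 2 * X n.+1 t).
Proof.
move=> t0; elim: n => [|n IHn].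
  rewrite /= mulr0 !mul0r.
  have -> : (fun s => \sum_(0 <= i < 0) X i.+1 s ^+ 2) = cst 0 :> (R -> R).
    by apply/funext => s; rewrite big_nil.
  exact: is_derive_cst.
have -> : (fun s => \sum_(0 <= i < n.+1) X i.+1 s ^+ 2) =
    (fun s => \sum_(0 <= i < n) X i.+1 s ^+ 2) + (fun s => X n.+1 s ^+ 2)
    :> (R -> R).
  by apply/funext => s; rewrite big_nat_recr.
have dX := has_derivative_ge0_is_derive t0 (@X_derive n t (ltW t0)).
apply: is_derive_eq.
rewrite /drift /GRing.scale/=; ring.
Qed.

Lemma energy_le (n : nat) (t : R) : 0 <= t ->
  \sum_(0 <= i < n) X i.+1 t ^+ 2 <= \sum_(0 <= i < n) x i.+1 ^+ 2.
Proof.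
move=> t0.
have -> : \sum_(0 <= i < n) x i.+1 ^+ 2 = \sum_(0 <= i < n) X i.+1 0 ^+ 2.
  by apply: eq_bigr => i _; have [_ _ ->] := X_sol.
have cE : {within `[0, t],
    continuous (fun s => \sum_(0 <= i < n) X i.+1 s ^+ 2)}.
  move=> s; apply: cvg_big => [|i _]; first exact: add_continuous.
  apply: cvgM; exact: X_continuous_segment.
apply: (ler0_derive1_le_cc _ _ cE) => //; rewrite ?in_itv/= ?lexx ?t0//.
- move=> s; rewrite in_itv/= => /andP[s0 _].
  exact/ex_derive/(is_derive_energy n s0).
- move=> s; rewrite in_itv/= => /andP[s0 _].
  rewrite derive1E; have [_ ->] := is_derive_energy n s0.
  have Xs := weak_solution_ge0 n (ltW s0).
  rewrite !mulNr oppr_le0 mulr_ge0//.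
  by rewrite mulr_ge0 ?sqr_ge0// mulr_ge0// k_ge0.
Qed.

End nonnegative_solution.

(** * Comparison with the ell2 norm of the initial condition *)

Lemma sum_sqr_le_ell2_norm {R : realType} (x : nat -> R) (n : nat) :
  in_ell2 x -> \sum_(0 <= i < n) x i.+1 ^+ 2 <= ell2_norm x ^+ 2.
Proof.
rewrite /in_ell2 /ell2_norm /finite_norm => xfin.
rewrite -lee_fin EFin_expe fineK ?ge0_fin_numE ?Lnorm_ge0//.
rewrite Lnorm_counting//.
set S := (\sum_(_ <oo) _)%E.
have -> : ((S `^ 2^-1) ^+ 2 = S)%E.
  have S0 : (0 <= S)%E by apply: nneseries_ge0 => *; exact: poweR_ge0.
  have [->|Sy] := eqVneq S +oo%E; first by rewrite poweRyr ?invr_neq0.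
  rewrite -(@fineK _ S) ?ge0_fin_numE ?lt_neqAle ?Sy ?leey//.
  rewrite poweR_EFin -EFin_expe -powR_mulrn ?powR_ge0// -powRrM mulVf//.
  by rewrite powRr1// fine_ge0.
apply: le_trans (nneseries_lim_ge n _) => [|*]; last exact: poweR_ge0.
rewrite -sumEFin; apply: lee_sum => i _ /=.
by rewrite /= lee_fin powR_mulrn// -normrX ler_norm.
Qed.

Lemma ell2_norm_gt0 (R : realType) (x : nat -> R) :
  in_ell2 x -> (exists n, (1 <= n)%N /\ x n <> 0) -> 0 < ell2_norm x.
Proof.
move=> x_ell2 [[|n] [//_ /eqP xn0]].
rewrite lt_neqAle fine_ge0 ?Lnorm_ge0// andbT eq_sym.
suff : 0 < ell2_norm x ^+ 2 by rewrite exprn_even_gt0.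
apply: lt_le_trans (sum_sqr_le_ell2_norm n.+1 x_ell2).
rewrite big_nat_recr//= ltr_wpDl ?exprn_even_gt0//.
by rewrite sumr_ge0// => i _; exact: sqr_ge0.
Qed.

Lemma weak_solution_le_norm (R : realType) (beta : R) (x : nat -> R)
    (X : nat -> R -> R) (n : nat) (t : R) :
  weak_solution beta x X -> (forall n, (1 <= n)%N -> 0 <= x n) -> in_ell2 x ->
  0 <= t -> X n.+1 t <= ell2_norm x.
Proof.
move=> X_sol x_ge0 x_ell2 t0.
have x0 : 0 <= ell2_norm x by rewrite fine_ge0// Lnorm_ge0.
rewrite -(@ler_pXn2r _ 2)// ?nnegrE ?(weak_solution_ge0 X_sol)//.
apply: le_trans (sum_sqr_le_ell2_norm n.+1 x_ell2).
apply: le_trans (energy_le X_sol x_ge0 n.+1 t0).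
by rewrite big_nat_recr//= lerDr sumr_ge0// => i _; exact: sqr_ge0.
Qed.

(** * From a weak-type bound to a logarithmic integral bound *)

Lemma integral_inv {R : realType} (a b : R) : 0 < a -> a < b ->
  (\int[@lebesgue_measure R]_(s in `[a, b]) (s^-1)%:E = (ln (b / a))%:E)%E.
Proof.
move=> a0 ab.
have b0 := lt_trans a0 ab.
have cln (s : R) : 0 < s -> ln x @[x --> s] --> ln s by exact: continuous_ln.
rewrite (@continuous_FTC2 _ _ (@ln R))//.
- by rewrite ln_div ?posrE// EFinB.
- apply: continuous_in_subspaceT => s; rewrite inE/= in_itv/= => /andP[as_ _].
  by apply: continuousV => //; rewrite gt_eqF// (lt_le_trans a0).
- split.
  + move=> s; rewrite in_itv/= => /andP[as_ _].
    by apply: ex_derive; apply: is_derive1_ln; exact: lt_trans as_.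
  + exact/cvg_at_right_filter/cln.
  + exact/cvg_at_left_filter/cln.
- move=> s; rewrite in_itv/= => /andP[as_ _].
  rewrite derive1E.
  have [_ ->//] := is_derive1_ln (lt_trans a0 as_).
Qed.

(** The expectation is the integral of the tail [ccdf Y], which vanishes beyond
    [K]. Bounding the tail by [1] up to [C], where the assumed bound [C / s]
    falls below [1], and by [C / s] from [C] to [K] gives [C] and
    [C * ln (K / C)]. *)
Lemma expectation_le_of_weak_type d (T : measurableType d) (R : realType)
    (P : probability T R) (Y : {RV P >-> R}) (C K : R) :
  0 < C -> C < K -> (forall w, 0 <= Y w) -> (forall w, Y w <= K) ->
  (forall s, 0 < s -> (ccdf Y s <= (C / s)%:E)%E) ->
  ('E_P[Y] <= (C * (1 + ln (K / C)))%:E)%E.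
Proof.
move=> C0 CK Y0 YK Ys.
have K0 := lt_trans C0 CK.
rewrite ge0_expectation_ccdf//.
(* Both indicators count the point [s = C]; this only enlarges the majorant. *)
pose h s := ((\1_(`[0, C] : set R) s)%:E +
  (C%:E * ((fun s : R => (s^-1)%:E) \_ `[C, K]) s))%E.
have inv0 s : (0 <= ((fun s : R => (s^-1)%:E) \_ `[C, K]) s)%E.
  apply: erestrict_ge0 => u /=; rewrite in_itv/= => /andP[Cu _].
  by rewrite lee_fin invr_ge0 (le_trans (ltW C0)).
have minv : measurable_fun setT ((fun s : R => (s^-1)%:E) \_ `[C, K]).
  apply/(measurable_restrictT _ _).1 => //.
  apply/measurable_EFinP.
  apply: subspace_continuous_measurable_fun => //.
  apply: continuous_in_subspaceT => s; rewrite inE/= in_itv/= => /andP[Cs _].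
  by apply: continuousV => //; rewrite gt_eqF// (lt_le_trans C0).
have mh : measurable_fun setT h.
  apply: emeasurable_funD; last exact: emeasurable_funM.
  exact/measurable_EFinP/measurable_indic.
apply: (@le_trans _ _ (\int[lebesgue_measure]_s h s)%E).
  rewrite integral_mkcond; apply: ge0_le_integral => //=.
  + move=> s _; apply: erestrict_ge0 => u _; exact: measure_ge0.
  + apply/(measurable_restrictT _ _).1 => //.
    exact: measurable_funTS (ccdf_measurable _).
  + move=> s _; rewrite /h [leLHS]patchE; case: ifPn => [|_]; last first.
      by rewrite adde_ge0 ?lee_fin// mule_ge0// lee_fin ltW.
    rewrite inE/= in_itv/= andbT => s0.
    have [sC|Cs] := leP s C.
      apply: le_trans (probability_le1 _ _) _ => //.
      rewrite indicE mem_set/= ?in_itv/= ?s0//.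
      by rewrite leeDl// mule_ge0// lee_fin ltW.
    have [sK|Ks] := leP s K.
      apply: le_trans (Ys _ _) _; first exact: lt_trans Cs.
      rewrite patchE mem_set/= ?in_itv/= ?sK ?(ltW Cs)// EFinM.
      by rewrite leeDr// lee_fin.
    have -> : ccdf Y s = 0%E.
      rewrite /ccdf /distribution/= /pushforward.
      rewrite (_ : _ @^-1` _ = set0) ?measure0//.
      apply/seteqP; split=> w //=; rewrite in_itv/= andbT => sY.
      by have := lt_trans Ks (lt_le_trans sY (YK w)); rewrite ltxx.
    by rewrite adde_ge0 ?lee_fin// mule_ge0// lee_fin ltW.
rewrite ge0_integralD//=; last 3 first.
- exact/measurable_EFinP/measurable_indic.
- by move=> s _; apply: mule_ge0; [rewrite lee_fin ltW|exact: inv0].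
- apply: emeasurable_funM => //; exact: minv.
rewrite ge0_integralZl//=; last by rewrite lee_fin ltW.
rewrite -integral_mkcond integral_inv// integral_indic// setIT/=.
rewrite lebesgue_measure_itv/= lte_fin C0.
by rewrite sube0 -EFinM -EFinD mulrDr mulr1.
Qed.

(** Under the uniform probability on [[0, T]] both the integral and the measure
    of the superlevel sets are divided by [T], so the weak-type constant becomes
    [C / T]. *)
Lemma integral_le_of_weak_type (R : realType) (f : R -> R) (T C K : R) :
  0 < T -> 0 < C -> C < K * T ->
  measurable_fun `[0, T] f ->
  (forall t, 0 <= t <= T -> 0 <= f t <= K) ->
  (forall s : R, 0 < s ->
    (@lebesgue_measure R [set t : R | (0 <= t <= T)%R /\ (s < f t)%R]
       <= (C / s)%:E)%E) ->
  (\int[@lebesgue_measure R]_(t in `[0%R, T]) (f t)%:E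
     <= (C * (1 + ln (K * T / C)))%:E)%E.
Proof.
move=> T0 C0 CKT mf fK fs.
have K0 : 0 < K by rewrite -(pmulr_lgt0 _ T0) (lt_trans C0).
(* Nothing is known of [f] outside [[0, T]]; replacing it there by [0] gives a
   globally measurable and bounded function. *)
pose Y0 : R -> R := f \_ `[0, T].
have Y0E t : 0 <= t <= T -> Y0 t = f t.
  by move=> tT; rewrite /Y0 patchE mem_set//= in_itv.
have Y0N t : ~ (0 <= t <= T) -> Y0 t = 0.
  by move=> tT; rewrite /Y0 patchE memNset//= in_itv.
have mY0 : measurable_fun setT Y0 by apply/(measurable_restrictT _ _).1.
pose P : probability (measurableTypeR R) R := uniform_prob T0.
pose Y : {RV P >-> R} := @mfun_Sub _ _ (measurableTypeR R) R _ (mem_set mY0).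
have Y_bnd t : 0 <= Y t <= K.
  have [tT|/negP tT] := boolP (0 <= t <= T).
    by rewrite -[Y t]/(Y0 t) Y0E// fK.
  by rewrite -[Y t]/(Y0 t) Y0N// lexx ltW.
have CT0 : 0 < C / T by rewrite divr_gt0.
have EY : ('E_P[Y] <= (C / T * (1 + ln (K / (C / T))))%:E)%E.
  apply: expectation_le_of_weak_type => // [|t|t|s s0].
  - by rewrite ltr_pdivrMr.
  - by have /andP[] := Y_bnd t.
  - by have /andP[] := Y_bnd t.
  have mYs : measurable (Y @^-1` `]s, +oo[).
    by rewrite -[X in measurable X]setTI; exact: (mY0).
  rewrite /ccdf /distribution/= /pushforward.
  rewrite -[X in P X]setIT -integral_indic//.
  rewrite (@integral_uniform _ _ _ T0); last 2 first.
    exact/measurable_EFinP/measurable_indic.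
    by move=> t; rewrite lee_fin.
  rewrite integral_indic// subr0 mulrAC EFinM muleC.
  apply: lee_wpmul2r; first by rewrite lee_fin invr_ge0 ltW.
  apply: le_trans (fs s s0); rewrite le_eqVlt; apply/orP; left; apply/eqP.
  congr (lebesgue_measure _); apply/seteqP; split => t /=.
    by rewrite !in_itv/= andbT => -[sY tT]; split=> //; rewrite -Y0E.
  by rewrite !in_itv/= andbT => -[tT sf]; split=> //; rewrite -Y0E in sf.
have -> : (\int[@lebesgue_measure R]_(t in `[0%R, T]) (f t)%:E =
           T%:E * 'E_P[Y])%E.
  rewrite expectation_def (@integral_uniform _ _ _ T0); last 2 first.
    exact/measurable_EFinP.
    by move=> t; rewrite lee_fin; have /andP[] := Y_bnd t.
  rewrite subr0 muleA -EFinM divff ?gt_eqF// mul1e.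
  by apply: eq_integral => t; rewrite inE/= in_itv/= => tT; rewrite -Y0E.
apply: le_trans (lee_wpmul2l _ EY) _; first by rewrite lee_fin ltW.
by rewrite -EFinM lee_fin mulrA mulrCA divff ?gt_eqF// mulr1 invf_div mulrA.
Qed.

(** * The bound on the integral of the cube *)

Theorem lemma14 (R : realType) (beta : R) (hbeta : 0 < beta)
    (c : R) (hc : 0 < c) (hP : property_P beta c)
    (x : nat -> R) (hx : in_ell2 x)
    (hx_neq0 : exists n, (1 <= n)%N /\ x n <> 0)
    (hx_ge0 : forall n, (1 <= n)%N -> 0 <= x n)
    (X : nat -> R -> R) (hX : weak_solution beta x X)
    (T : R) (hT : 0 < T) (N : nat) (hN : (1 <= N)%N)
    (hNT : c * (ell2_norm x)^-1 < k beta N * T) :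
  (\int[@lebesgue_measure R]_(t in `[0%R, T]) (X N t ^+ 3)%:E
     <= (c * ell2_norm x ^+ 2 / k beta N
         * (1 + ln (ell2_norm x * T / c) + N%:R * beta * ln 2))%:E)%E.
Proof.
case: N hN hNT => [//|N] hN hNT.
have x0 := ell2_norm_gt0 hx hx_neq0.
have k0 : 0 < k beta N.+1 by exact: powR_gt0.
(* Values of [X] at negative times are arbitrary, hence the restriction to sets
   of nonnegative times. *)
have mX (D : set R) :
    measurable D -> D `<=` [set t | 0 <= t] -> measurable_fun D (X N.+1).
  move=> mD D0; apply: subspace_continuous_measurable_fun => //.
  exact: continuous_subspaceW D0 (@weak_solution_continuous _ _ _ _ hX N).
pose C := c * ell2_norm x ^+ 2 / k beta N.+1.
have C0 : 0 < C by rewrite divr_gt0// mulr_gt0// exprn_gt0.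
have lnE : ln (ell2_norm x ^+ 3 * T / C) =
    ln (ell2_norm x * T / c) + N.+1%:R * beta * ln 2.
  have -> : ell2_norm x ^+ 3 * T / C = ell2_norm x * T / c * k beta N.+1.
    by rewrite /C; field; rewrite !gt_eqF.
  rewrite lnM ?posrE ?divr_gt0 ?mulr_gt0//; congr (_ + _).
  by rewrite ln_powR (mulrC beta).
rewrite -addrA -lnE.
apply: integral_le_of_weak_type => //.
- rewrite /C ltr_pdivrMr//.
  move: hNT; rewrite ltr_pdivrMr// => hNT.
  have -> : ell2_norm x ^+ 3 * T * k beta N.+1 =
    (k beta N.+1 * T * ell2_norm x) * ell2_norm x ^+ 2 by ring.
  by rewrite ltr_pM2r// exprn_gt0.
- apply: measurable_funX; apply: mX => // t /=.
  by rewrite in_itv/= => /andP[].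
- move=> t /andP[t0 _].
  have X0 := weak_solution_ge0 hX hx_ge0 N t0.
  rewrite exprn_ge0//= lerXn2r ?nnegrE ?(ltW x0)//.
  exact: weak_solution_le_norm hX hx_ge0 hx t0.
move=> s s0.
have [M M0 sE] : exists2 M, 0 < M & s = M ^+ 3.
  exists (s `^ 3^-1); first exact: powR_gt0.
  rewrite -powR_mulrn ?powR_ge0// -powRrM mulVf ?pnatr_eq0// powRr1//.
  exact: ltW.
have -> : C / s = c * ell2_norm x ^+ 2 / (k beta N.+1 * M ^+ 3).
  by rewrite /C sE; field; rewrite !gt_eqF.
apply: le_trans (hP _ _ hx hx_ge0 hX N.+1 M hN M0).
have mgt (D : set R) (a : R) : measurable D -> D `<=` [set t | 0 <= t] ->
    measurable (D `&` [set t | a < X N.+1 t]).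
  move=> mD D0.
  have -> : [set t | a < X N.+1 t] = X N.+1 @^-1` `]a, +oo[.
    by apply/seteqP; split=> t /=; rewrite in_itv/= andbT.
  exact: mX.
have le3 t : 0 <= t -> (s < X N.+1 t ^+ 3) = (M < X N.+1 t).
  move=> t0; rewrite sE ltr_pXn2r// nnegrE ?(ltW M0)//.
  exact: (weak_solution_ge0 hX hx_ge0).
rewrite [X in (_ X <= _)%E](_ : _ =
    `[0, T] `&` [set t | M < X N.+1 t]); last first.
  by apply/seteqP; split=> t /=; rewrite in_itv/= => -[tT]; rewrite le3//;
    case/andP: tT.
rewrite [X in (_ <= _ X)%E](_ : _ =
    `[0, +oo[ `&` [set t | M < X N.+1 t]); last first.
  by apply/seteqP; split=> t /=; rewrite in_itv/= andbT.
apply: le_measure; rewrite ?inE.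
- by apply: mgt => // t /=; rewrite in_itv/= => /andP[].
- by apply: mgt => // t /=; rewrite in_itv/= andbT.
- by apply: setSI => t /=; rewrite !in_itv/= andbT => /andP[].
Qed.
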